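(* For each mesh size $h>0$ in the considered family, let $a : V_h \times V_h \to \mathbb{R}$ be a symmetric bilinear form, uniformly coercive with respect to $h$, and let $a_h : V_h\times V_h \to \mathbb{R}$ be a bilinear form, such that $$\lim_{h \to 0^+} \ \sup_{0 \neq v_h, w_h \in V_h} \frac{|a_h(w_h,v_h) - a(w_h,v_h)|}{\|w_h\|_{H^1(\Omega)} \, \|v_h\|_{H^1(\Omega)}} = 0 .$$ Let $A$ and $A_*$ be the $N\times N$ matrices associated to $a(\cdot,\cdot)$ and $a_h(\cdot,\cdot)$, respectively, with respect to any basis of $V_h$ (the same basis for both), where $N=\dim V_h$. Let $\Lambda$ and $\Lambda_*$ denote the spectra of $A$ and $A_*$, respectively. Then $$\lim_{h\to 0^+} \ \max_{\lambda_*\in\Lambda_*} \ \min_{\lambda\in\Lambda} \ \frac{|\lambda-\lambda_*|}{\lambda} = 0 .$$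
   Context: Spaces. Let $d\in\{2,3\}$ and let $p,m$ be positive integers. For each direction $l=1,\dots,d$ consider an open knot vector $\Xi_l=\{\xi_1,\dots,\xi_{m+p+1}\}$ with $0=\xi_1=\dots=\xi_{p+1}<\xi_{p+2}\le\dots\le\xi_m<\xi_{m+1}=\dots=\xi_{m+p+1}=1$ (the knots may depend on $l$; repeated internal knots are allowed up to multiplicity $p$). Let $\hat B_{l,i}$, $i=0,\dots,m-1$, be the associated univariate B-spline basis functions of degree $p$. For a multi-index $\boldsymbol{i}=(i_1,\dots,i_d)$ set $\hat B_{\boldsymbol{i}}(\xi)=\hat B_{1,i_1}(\xi_1)\cdots\hat B_{d,i_d}(\xi_d)$ for $\xi=(\xi_1,\dots,\xi_d)\in[0,1]^d$. The domain $\Omega\subset\mathbb{R}^d$ is given by a single-patch spline parametrization: $\Omega=\mathbf{F}([0,1]^d)$ with $\mathbf{F}=\sum_{\boldsymbol{i}}\mathbf{C}_{\boldsymbol{i}}\hat B_{\boldsymbol{i}}$, $\mathbf{C}_{\boldsymbol{i}}\in\mathbb{R}^d$, where $\mathbf{F}$ is invertible and the functions $\hat B_{\boldsymbol{i}}\circ\mathbf{F}^{-1}$ belong to $H^1(\Omega)$. The space is $$V_h=\mathrm{span}\{\hat B_{\boldsymbol{i}}\circ\mathbf{F}^{-1} : \boldsymbol{i}=(i_1,\dots,i_d),\ 1\le i_l\le m-2,\ 1\le l\le d\},$$ with $N=\dim V_h=(m-2)^d\ge 1$. Here $h$ denotes the mesh size (maximal length of a knot span); one has a family of such spaces, with $\Omega$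 fixed, indexed by values of $h$ accumulating at $0$, and limits $h\to0^+$ are taken along this family. Uniform coercivity means that there is a constant $\alpha>0$ independent of $h$ such that $a(v_h,v_h)\ge\alpha\|v_h\|_{H^1(\Omega)}^2$ for all $v_h\in V_h$ and all $h$. The matrix associated to a bilinear form $b$ on $V_h$ with respect to a basis $\varphi_1,\dots,\varphi_N$ is the matrix $B$ with $B_{ij}=b(\varphi_j,\varphi_i)$, so that $v^TBw=b(w_h,v_h)$ for $v_h=\sum_i v_i\varphi_i$, $w_h=\sum_i w_i\varphi_i$. The form $a_h$ need not be symmetric, so $\Lambda_*$ is a set of complex eigenvalues in general. *)

(* Defs.v *)
From HB Require Import structures.
From mathcomp Require Import all_boot all_order all_algebra.
From mathcomp Require Import all_classical all_reals all_analysis.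
From mathcomp Require Import complex.

Set Implicit Arguments.
Unset Strict Implicit.
Unset Printing Implicit Defensive.
Import Order.TTheory GRing.Theory Num.Theory.
Import numFieldNormedType.Exports.

Local Open Scope classical_set_scope.
Local Open Scope ring_scope.

Fact measure_rV_display : measure_display.
Proof. exact: default_measure_display. Qed.

(* The sigma-algebra on R^n generated by the coordinate projections, i.e. the
   Borel sigma-algebra. *)
Section measurable_rV.
Context {R : realType}.
Variable n : nat.

Definition rV_coord (i : 'I_n) (v : 'rV[R]_n) : measurableTypeR R := v ord0 i.

Let rV_set0 : g_sigma_preimage rV_coord set0.
Proof. exact: sigma_algebra0. Qed.

Let rV_setC A : g_sigma_preimage rV_coord A -> g_sigma_preimage rV_coord (~` A).
Proof. exact: sigma_algebraC. Qed.

Let rV_bigcup (F : _^nat) : (forall i, g_sigma_preimage rV_coord (F i)) ->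
  g_sigma_preimage rV_coord (\bigcup_i (F i)).
Proof. exact: sigma_algebra_bigcup. Qed.

HB.instance Definition _ := @isMeasurable.Build measure_rV_display
  'rV[R]_n (g_sigma_preimage rV_coord) rV_set0 rV_setC rV_bigcup.

End measurable_rV.

Lemma measurable_rV_coord (R : realType) n (i : 'I_n) :
  measurable_fun [set: 'rV[R]_n] (rV_coord i).
Proof.
move=> _ Y mY; rewrite setTI; apply: sub_sigma_algebra => /=.
rewrite -bigcup_seq/=; exists i => /=; first by rewrite mem_index_enum.
by exists Y => //; rewrite setTI.
Qed.

Lemma measurable_fun_rV (R : realType) d (T : measurableType d) n
    (f : T -> 'rV[R]_n) :
  (forall i, measurable_fun [set: T] (rV_coord i \o f)) ->
  measurable_fun [set: T] f.
Proof.
move=> mf _ A mA; rewrite setTI.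
have: preimage_set_system [set: T] f (g_sigma_preimage (@rV_coord R n)) (f @^-1` A).
  by exists A => //; rewrite setTI.
rewrite -g_sigma_preimage_comp.
apply: smallest_sub; first exact: sigma_algebra_measurable.
rewrite -bigcup_seq => B [i _ [C mC <-]]; exact: mf.
Qed.

Section lebesgue_rV.
Context {R : realType}.

Definition rV_cons n (xv : measurableTypeR R * 'rV[R]_n) : 'rV[R]_n.+1 :=
  \row_i oapp (xv.2 ord0) xv.1 (unlift ord0 i).

Definition rV_uncons n (v : 'rV[R]_n.+1) : measurableTypeR R * 'rV[R]_n :=
  (v ord0 ord0, \row_i v ord0 (lift ord0 i)).

Lemma rV_consK n : cancel (@rV_cons n) (@rV_uncons n).
Proof.
move=> [x v]; congr (_, _) => /=; first by rewrite mxE unlift_none.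
by apply/rowP => i; rewrite !mxE liftK.
Qed.

Lemma rV_unconsK n : cancel (@rV_uncons n) (@rV_cons n).
Proof. by move=> v; apply/rowP => i; rewrite mxE; case: unliftP => [j|] ->; rewrite /= ?mxE. Qed.

Lemma measurable_rV_cons n : measurable_fun setT (@rV_cons n).
Proof.
apply: measurable_fun_rV => i; case: (unliftP ord0 i) => [j|] ->.
  rewrite (_ : _ \o _ = rV_coord j \o snd).
    by apply: measurableT_comp => //; exact: measurable_rV_coord.
  by apply/funext => xv; rewrite /rV_coord /= mxE liftK.
rewrite (_ : _ \o _ = fst)//.
by apply/funext => xv; rewrite /rV_coord /= mxE unlift_none.
Qed.

Lemma measurable_rV_uncons n : measurable_fun setT (@rV_uncons n).
Proof.
apply/measurable_fun_pairP; split; first exact: (measurable_rV_coord ord0).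
apply: measurable_fun_rV => i.
rewrite (_ : _ \o _ = rV_coord (lift ord0 i)); first exact: measurable_rV_coord.
by apply/funext => v; rewrite /rV_coord /= mxE.
Qed.

Section step.
Variables (n : nat) (mu : {sigma_finite_measure set 'rV[R]_n -> \bar R}).

Definition lebesgue_rV_step : set 'rV[R]_n.+1 -> \bar R :=
  pushforward (lebesgue_measure \x mu)%E (@rV_cons n).

Let step0 : lebesgue_rV_step set0 = 0%E.
Proof. by rewrite /lebesgue_rV_step /pushforward preimage_set0 measure0. Qed.

Let step_ge0 A : (0 <= lebesgue_rV_step A)%E.
Proof. by rewrite /lebesgue_rV_step /pushforward measure_ge0. Qed.

Let step_sigma_additive : semi_sigma_additive lebesgue_rV_step.
Proof.
exact: (@measure_semi_sigma_additive _ _ _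
  (measure_function_pushforward__canonical__measure_function_Measure
    (lebesgue_measure \x mu)%E (@measurable_rV_cons n))).
Qed.

HB.instance Definition _ := isMeasure.Build _ _ _ lebesgue_rV_step
  step0 step_ge0 step_sigma_additive.

Let step_sigma_finite : sigma_finite setT lebesgue_rV_step.
Proof.
have /sigma_finiteP[E [ET ndE Eoo]] := sigma_finiteT (@lebesgue_measure R).
have /sigma_finiteP[F [FT ndF Foo]] := sigma_finiteT mu.
exists (fun k => @rV_uncons n @^-1` (E k `*` F k)).
  rewrite -preimage_bigcup (_ : \bigcup_k _ = setT) ?preimage_setT//.
  rewrite -setXTT ET FT predeqE => -[x y]; split.
    by move=> [k _ []/= ? ?]; split; exists k.
  move=> [/= [k _ Ekx] [l _ Fly]]; exists (maxn k l) => //; split.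
  - by move: x Ekx; exact/subsetPset/ndE/leq_maxl.
  - by move: y Fly; exact/subsetPset/ndF/leq_maxr.
move=> k; have [mE Ek] := Eoo k; have [mF Fk] := Foo k; split.
  rewrite -[X in measurable X]setTI.
  by apply: measurable_rV_uncons => //; exact: measurableX.
rewrite /lebesgue_rV_step /pushforward (_ : _ @^-1` _ = E k `*` F k).
  by rewrite product_measure1E// lte_mul_pinfty// ge0_fin_numE.
rewrite -comp_preimage (_ : _ \o _ = idfun) ?preimage_id//.
by apply/funext => xv; exact: rV_consK.
Qed.

HB.instance Definition _ := Measure_isSigmaFinite.Build _ _ _ lebesgue_rV_step
  step_sigma_finite.

End step.

(* Lebesgue measure on R^n, as an iterated product of Lebesgue measures on R. *)
Fixpoint lebesgue_rV n : {sigma_finite_measure set 'rV[R]_n -> \bar R} :=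
  if n is n'.+1 then lebesgue_rV_step (lebesgue_rV n') else \d_(0 : 'rV[R]_0).

Let box n (a b : 'rV[R]_n) :=
  [set v : 'rV[R]_n | forall i, a ord0 i <= v ord0 i <= b ord0 i].

Let measurable_box n (a b : 'rV[R]_n) : measurable (box a b).
Proof.
rewrite (_ : box a b =
    \big[setI/setT]_i (rV_coord i @^-1` `[a ord0 i, b ord0 i])).
  apply: bigsetI_measurable => i _; rewrite -[X in measurable X]setTI.
  by apply: measurable_rV_coord => //; exact: measurable_itv.
rewrite -bigcap_seq; apply/seteqP; split => v /= vab i.
  by move=> _ /=; rewrite in_itv/=; exact: vab.
by have /= := vab i (mem_index_enum i); rewrite in_itv.
Qed.

Lemma lebesgue_rV_box n (a b : 'rV[R]_n) :
  (forall i, a ord0 i <= b ord0 i) ->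
  lebesgue_rV n [set v | forall i, a ord0 i <= v ord0 i <= b ord0 i] =
  (\prod_i (b ord0 i - a ord0 i))%:E.
Proof.
elim: n a b => [|n IHn] a b ab.
  by rewrite big_ord0 /= diracE mem_set//= => -[].
rewrite /= /lebesgue_rV_step /pushforward.
pose tl (c : 'rV[R]_n.+1) : 'rV[R]_n := (rV_uncons c).2.
rewrite (_ : _ @^-1` _ =
    `[a ord0 ord0, b ord0 ord0]%classic `*` box (tl a) (tl b)).
  rewrite product_measure1E//; last exact: measurable_box.
  rewrite IHn => [|i]; last by rewrite !mxE.
  rewrite [X in (X * _)%E](_ : _ = lebesgue_measure
    `[a ord0 ord0, b ord0 ord0]%classic)// lebesgue_measure_itv/=.
  rewrite lte_fin big_ord_recl.
  under eq_bigr do rewrite !mxE.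
  have := ab ord0; rewrite le_eqVlt => /orP[/eqP->|->].
    by rewrite ltxx subrr mul0e mul0r.
  by rewrite -EFinB -EFinM.
apply/seteqP; split => -[x v] /=.
  move=> xvab; split; first by have := xvab ord0; rewrite mxE unlift_none in_itv.
  by move=> i; have := xvab (lift ord0 i); rewrite !mxE liftK.
rewrite in_itv => -[xab vab] i; case: (unliftP ord0 i) => [j|] ->.
  by have := vab j; rewrite !mxE liftK.
by rewrite mxE unlift_none.
Qed.

End lebesgue_rV.

Section sobolev.
Context {R : realType} {d : nat}.
Implicit Types (O : set 'rV[R]_d) (u v g f : 'rV[R]_d -> R).

(* Equality of the classes of u and v in L^2(O). *)
Definition eq_ae O u v : Prop := ae_eq (lebesgue_rV d) O u v.

(* u \_ O is the extension of u by zero outside O. *)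
Definition L2 O u : Prop := (u \_ O) \in Lfun (lebesgue_rV d) 2%:E.

Definition L2norm O u : R := fine ('N[lebesgue_rV d]_2%:E[EFin \o (u \_ O)]).

Definition partial (l : 'I_d) f : 'rV[R]_d -> R :=
  fun x => 'D_(delta_mx ord0 l) f x.

(* C^oo: all iterated partial derivatives are (Frechet) differentiable. *)
Definition smooth f : Prop :=
  forall (s : seq 'I_d) x, differentiable (foldr partial f s) x.

Definition test_function O f : Prop :=
  smooth f /\ exists K : set 'rV[R]_d,
    [/\ compact K, K `<=` O & forall x, ~ K x -> f x = 0].

Definition is_weak_partial O (l : 'I_d) u g : Prop :=
  forall f, test_function O f ->
    (\int[lebesgue_rV d]_(x in O) (u x * partial l f x)%:E =
     - \int[lebesgue_rV d]_(x in O) (g x * f x)%:E)%E.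

Definition H1 O u : Prop :=
  L2 O u /\ forall l, exists g, L2 O g /\ is_weak_partial O l u g.

(* A representative of the weak partial derivative, which is unique up to
   equality almost everywhere (0 if it does not exist). *)
Definition weak_partial O (l : 'I_d) u : 'rV[R]_d -> R :=
  xget (cst 0) [set g | L2 O g /\ is_weak_partial O l u g].

Definition H1norm O u : R :=
  Num.sqrt (L2norm O u ^+ 2 + \sum_l L2norm O (weak_partial O l u) ^+ 2).

End sobolev.

Section splines.
Context {R : realType}.

(* Cox-de Boor recursion for the knots t 0 <= t 1 <= ...; x / 0 = 0 implements
   the convention 0 / 0 = 0. The last nonempty knot span is closed at the right
   end point 1, so that the functions are left-continuous there. *)
Fixpoint bspline (t : nat -> R) (p i : nat) (x : R) : R :=
  if p is p'.+1 then
    (x - t i) / (t (i + p)%N - t i) * bspline t p' i x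
    + (t (i + p).+1%N - x) / (t (i + p).+1%N - t i.+1) * bspline t p' i.+1 x
  else
    ((t i <= x < t i.+1) || [&& x == 1, t i < t i.+1 & t i.+1 == 1])%:R.

(* Only the values t 0, ..., t (m + p), i.e. xi_1, ..., xi_(m+p+1), matter. *)
Definition open_knot_vector (p m : nat) (t : nat -> R) : Prop :=
  [/\ forall i, (i <= p)%N -> t i = 0,
      forall i, (m <= i <= m + p)%N -> t i = 1,
      forall i, (i < m + p)%N -> t i <= t i.+1,
      t p < t p.+1 /\ t m.-1 < t m
    & (* interior knots have multiplicity at most p *)
      forall i, (p < i)%N -> (i + p < m)%N -> t i < t (i + p)%N].

Record spline_patch (d : nat) := SplinePatch {
  degree : nat;
  nbasis : nat;
  knots : 'I_d -> nat -> R;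
  control : {ffun 'I_d -> 'I_nbasis} -> 'rV[R]_d
}.

Section patch.
Context {d : nat}.
Variable P : spline_patch d.
Local Notation m := (nbasis P).
Local Notation multi_index := {ffun 'I_d -> 'I_m}.

Definition unit_cube : set 'rV[R]_d :=
  [set x | forall l, 0 <= x ord0 l <= 1].

Definition tensor_bspline (i : multi_index) (x : 'rV[R]_d) : R :=
  \prod_l bspline (knots P l) (degree P) (i l) (x ord0 l).

Definition param (x : 'rV[R]_d) : 'rV[R]_d :=
  \sum_i tensor_bspline i x *: control i.

Definition patch_domain : set 'rV[R]_d := param @` unit_cube.

(* The function B_i o F^-1 on Omega, extended by zero to R^d. *)
Definition basis_fun (i : multi_index) : 'rV[R]_d -> R :=
  (tensor_bspline i \o pinv unit_cube param) \_ patch_domain.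

Definition inner_index (i : multi_index) : bool :=
  [forall l, (1 <= i l <= m - 2)%N].

Definition Vh : set ('rV[R]_d -> R) :=
  [set u | exists c : multi_index -> R,
     u = \sum_(i | inner_index i) c i *: basis_fun i].

Definition dim_Vh : nat := ((m - 2) ^ d)%N.

Definition mesh_size : R :=
  \big[Num.max/0]_(l < d) \big[Num.max/0]_(i < m + degree P)
    (knots P l i.+1 - knots P l i).

(* patch_domain° is Omega as an open set, over which H^1(Omega) is taken. *)
Definition admissible_patch : Prop :=
  [/\ (0 < degree P)%N,
      (0 < dim_Vh)%N,
      forall l, open_knot_vector (degree P) m (knots P l),
      {in unit_cube &, injective param}
    & forall i, H1 patch_domain° (basis_fun i)].

End patch.
End splines.
Arguments spline_patch : clear implicits.

Section forms.
Context {R : realType} {d : nat}.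
Local Notation E := ('rV[R]_d -> R).
Implicit Types (O : set 'rV[R]_d) (V : set E) (b c : E -> E -> R).

Definition bilinear_on V b : Prop :=
  (forall k u v w, V u -> V v -> V w -> b (k *: u + v) w = k * b u w + b v w) /\
  (forall k u v w, V u -> V v -> V w -> b w (k *: u + v) = k * b w u + b w v).

Definition symmetric_on V b : Prop := forall u v, V u -> V v -> b u v = b v u.

(* phi is a basis of V, seen as a subspace of H^1(O), in which functions that
   are equal almost everywhere are identified. *)
Definition basis_on O V n (phi : 'I_n -> E) : Prop :=
  [/\ forall k, V (phi k),
      forall v, V v -> exists c : 'I_n -> R, eq_ae O v (\sum_k c k *: phi k)
    & forall c : 'I_n -> R, eq_ae O (\sum_k c k *: phi k) 0 ->
        forall k, c k = 0].

Definition form_matrix b n (phi : 'I_n -> E) : 'M[R]_n :=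
  \matrix_(i, j) b (phi j) (phi i).

(* The supremum over w, v in V \ {0} of |b(w,v) - c(w,v)| / (||w|| ||v||). *)
Definition form_error O V b c : \bar R :=
  ereal_sup [set e | exists w v : E,
    [/\ V w /\ V v, ~ eq_ae O w 0, ~ eq_ae O v 0
      & e = (`|b w v - c w v| / (H1norm O w * H1norm O v))%:E]].

End forms.

Section spectra.
Context {R : realType}.

Definition spectrum n (M : 'M[R]_n) : set R[i]%C :=
  [set z | eigenvalue (map_mx (real_complex R) M) z].

(* max over l' in spectrum B of min over l in spectrum A of |l - l'| / l. The
   quotient is computed in the complex numbers; Re only casts it to R (it is
   applied to matrices A whose eigenvalues are positive real numbers). *)
Definition relative_spectral_error n (A B : 'M[R]_n) : \bar R :=
  ereal_sup [set ereal_inf [set (complex.Re (`|l - l'| / l))%:E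
    | l in spectrum A] | l' in spectrum B].

End spectra.

(* Main.v *)
Require Import Defs.
From HB Require Import structures.
From mathcomp Require Import all_boot all_order all_algebra.
From mathcomp Require Import all_classical all_reals all_analysis.
From mathcomp Require Import complex.
From mathcomp Require Import measurable_realfun.
From mathcomp Require Import ring.
Import Order.TTheory GRing.Theory Num.Theory.
Import numFieldNormedType.Exports.
Local Open Scope classical_set_scope.
Local Open Scope ring_scope.

(** The statement is quantitative: for each mesh size, the relative spectral
    error is at most [alpha^-1] times the form error, where [alpha] is the
    coercivity constant ([spectral_error_le_form_error]). As [alpha] does not
    depend on [h], the limit follows by squeezing.

    The bound is a Bauer-Fike argument in the energy inner product. Let [A] and
    [B] be the matrices of [a] and [a_h], and let [e] be the form error.
    Coercivity turns the [H^1] norms into energy norms: with [c = e / alpha],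
    [|u (B - A) v^T| <= c |u|_A |v|_A] where [|u|_A^2 = u A u^T]. Suppose that
    [x B = l' x] with [x <> 0], and diagonalise [A = U^-1 diag(d) U] with [U]
    unitary; all [d_i] are positive. In the coordinates [x = y U], test the
    identity [x (B - A) = x (l' - A)] against [z = t U], where
    [t_i = (l' - d_i) y_i / d_i]. This choice makes [x (B - A) z^*] equal to
    [|z|_A^2], so [|z|_A <= c |x|_A], that is
    [\sum_i |l' - d_i|^2 |y_i|^2 / d_i <= c^2 \sum_i d_i |y_i|^2], and hence
    [|l' - d_i| <= c d_i] for some [i] ([relative_perturbation]).

    Since [B] need not be symmetric, [l'], [x] and [z] are complex, whereas the
    hypotheses concern real vectors. Only the real part of [x (B - A) z^*] is
    used, and for a real matrix it splits into the contributions of the real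
    and of the imaginary parts ([Re_sesq_real]), so that no constant is lost.
    To avoid square roots, the bound on [B - A] is used in the form
    [2 u (B - A) v^T <= c^2 |u|_A^2 + |v|_A^2], which follows from it by the
    arithmetic-geometric mean inequality.

    As the form error is a supremum of quotients, it controls the forms only
    where the [H^1] norm does not vanish. This holds for the nonzero
    combinations of the basis: they are square integrable and not almost
    everywhere zero ([H1norm_gt0]). *)

Local Open Scope sesquilinear_scope.

(** * Relative perturbation of the spectrum of a Hermitian matrix *)

Definition sesq {C : numClosedFieldType} {n} (M : 'M[C]_n) (x z : 'rV[C]_n) : C :=
  (x *m M *m z ^t*) ord0 ord0.

Lemma sesqE {C : numClosedFieldType} {n} (M : 'M[C]_n) x z :
  sesq M x z = \sum_i \sum_j x ord0 i * M i j * (z ord0 j)^*.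
Proof.
rewrite /sesq !mxE exchange_big; apply: eq_bigr => j _ /=.
by rewrite !mxE mulr_suml; apply: eq_bigr => i _.
Qed.

Lemma sesqB {C : numClosedFieldType} {n} (A B : 'M[C]_n) x z :
  sesq (B - A) x z = sesq B x z - sesq A x z.
Proof. by rewrite /sesq mulmxBr mulmxBl !mxE. Qed.

Lemma sesq_diag {C : numClosedFieldType} {n} (U : 'M[C]_n) (d u v : 'rV[C]_n) :
  U \is unitarymx ->
  sesq (invmx U *m diag_mx d *m U) (u *m U) (v *m U) =
  \sum_i d ord0 i * (u ord0 i * (v ord0 i)^*).
Proof.
move=> Uu; rewrite /sesq trmx_mul map_mxM invmx_unitary // !mulmxA.
rewrite !(mulmxtVK _ Uu) mul_mx_diag !mxE.
by apply: eq_bigr => i _; rewrite !mxE; ring.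
Qed.

(** Relative Bauer-Fike bound: the left eigenvectors of [B] are tested against
    vectors chosen in the eigenbasis of [A]. *)
Lemma relative_perturbation {C : numClosedFieldType} {n} (A B : 'M[C]_n) (c : C) :
  0 <= c -> A \is hermsymmx ->
  (forall x, x != 0 -> 0 < 'Re (sesq A x x)) ->
  (forall x z, 'Re (sesq (B - A) x z) *+ 2 <=
     c ^+ 2 * 'Re (sesq A x x) + 'Re (sesq A z z)) ->
  forall l', eigenvalue B l' ->
  exists l, [/\ eigenvalue A l, 0 < l & `|l - l'| <= c * l].
Proof.
move=> c_ge0 Aherm Apos close l' /eigenvalueP[x xB x_neq0].
have Uunit := spectral_unitarymx A; have Uinv := spectral_unit A.
have /orthomx_spectralP Aeq := hermitian_normalmx Aherm.
have d_real i : 'Re (spectral_diag A ord0 i) = spectral_diag A ord0 i.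
  by apply/Creal_ReP/mxOverP; exact: hermitian_spectral_diag_real.
set U := spectralmx A in Uunit Uinv Aeq *; set d := spectral_diag A in d_real Aeq *.
have d_eigen i : eigenvalue A (d ord0 i).
  apply/eigenvalueP; exists (row i U).
    rewrite {1}rowE [in LHS]Aeq -!mulmxA mulKVmx // mulmxA -rowE row_diag_mx.
    by rewrite -scalemxAl -rowE.
  apply: contraTneq Uinv => Ui0; rewrite unitmxE unitfE negbK.
  rewrite (expand_det_row U i) big1 // => j _.
  by move/rowP/(_ j): Ui0; rewrite !mxE => ->; rewrite mul0r.
have d_gt0 i : 0 < d ord0 i.
  have /eigenvalueP[v vA v_neq0] := d_eigen i.
  have := Apos _ v_neq0; rewrite /sesq vA -scalemxAl mxE mxE.
  have vv : 0 < \sum_j `|v ord0 j| ^+ 2.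
    rewrite lt0r sumr_ge0 ?andbT => [|j _]; last exact: exprn_ge0.
    apply: contra v_neq0 => /eqP/psumr_eq0P v0; apply/eqP/rowP => j; rewrite mxE.
    by apply/eqP; rewrite -normr_eq0 -sqrf_eq0 v0 // => k _; exact: exprn_ge0.
  under eq_bigr do rewrite !mxE -normCK.
  rewrite (Creal_ReP _ _) ?pmulr_lgt0 // realM ?(gtr0_real vv) //.
  by rewrite -d_real Creal_Re.
(* Every [d_i] is an eigenvalue of [A]: it remains to exclude that all of them
   are relatively far from [l']. *)
have := boolP [exists i, `|d ord0 i - l'| <= c * d ord0 i].
case=> [/existsP[i di]|/existsPn far]; first by exists (d ord0 i).
pose y := x *m invmx U.
have xE : x = y *m U by rewrite mulmxKV.
pose t := \row_i ((l' - d ord0 i) * y ord0 i / d ord0 i).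
have sA u v : sesq A (u *m U) (v *m U) =
    \sum_i d ord0 i * (u ord0 i * (v ord0 i)^*).
  by rewrite {1}Aeq sesq_diag.
have sB v : sesq B x (v *m U) = \sum_i l' * (y ord0 i * (v ord0 i)^*).
  rewrite /sesq xB -scalemxAl mxE trmx_mul map_mxM mulmxA -invmx_unitary //.
  rewrite mxE mulr_sumr.
  by apply: eq_bigr => i _; rewrite !mxE.
have sAr u : 'Re (sesq A (u *m U) (u *m U)) = \sum_i d ord0 i * `|u ord0 i| ^+ 2.
  rewrite sA (_ : \sum_i _ = \sum_i d ord0 i * `|u ord0 i| ^+ 2); last first.
    by apply: eq_bigr => i _; rewrite normCK.
  apply/Creal_ReP/ger0_real/sumr_ge0 => i _.
  by rewrite mulr_ge0 ?exprn_ge0 // ltW.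
(* The choice of [t] turns the perturbation into the energy of [t *m U]. *)
have key : 'Re (sesq (B - A) x (t *m U)) = 'Re (sesq A (t *m U) (t *m U)).
  rewrite sesqB sB {1}xE !sA -sumrB; congr ('Re _); apply: eq_bigr => i _.
  rewrite !mxE -mulrBl !mulrA; congr (_ * _); field; exact: lt0r_neq0.
have : \sum_i d ord0 i * (`|t ord0 i| ^+ 2 - c ^+ 2 * `|y ord0 i| ^+ 2) <= 0.
  under eq_bigr do rewrite mulrBr [X in _ - X]mulrCA.
  rewrite sumrB -mulr_sumr -!sAr -xE subr_le0.
  by have := close x (t *m U); rewrite key mulr2n lerD2r.
have nrm i : `|t ord0 i| = `|l' - d ord0 i| * `|y ord0 i| / d ord0 i.
  by rewrite mxE !normrM normfV (gtr0_norm (d_gt0 i)).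
have term i : y ord0 i != 0 ->
    0 < d ord0 i * (`|t ord0 i| ^+ 2 - c ^+ 2 * `|y ord0 i| ^+ 2).
  move=> yi; rewrite mulr_gt0 // subr_gt0 -exprMn ltrXn2r ?nnegrE ?mulr_ge0 //=.
  rewrite nrm.
  rewrite mulrAC ltr_pM2r ?normr_gt0 // ltr_pdivlMr // distrC.
  by rewrite real_ltNge ?(far i) // ?realM // ?ger0_real // ltW //.
have term_ge0 i :
    0 <= d ord0 i * (`|t ord0 i| ^+ 2 - c ^+ 2 * `|y ord0 i| ^+ 2).
  have [yi0|/term/ltW//] := eqVneq (y ord0 i) 0.
  by rewrite nrm yi0 !(normr0, mulr0, mul0r, expr0n) subr0 mulr0.
move=> sum_le0.
have sum0 :
    \sum_i d ord0 i * (`|t ord0 i| ^+ 2 - c ^+ 2 * `|y ord0 i| ^+ 2) = 0.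
  by apply/eqP; rewrite eq_le sum_le0 sumr_ge0.
have y0 : y = 0.
  apply/rowP => i; rewrite [RHS]mxE; apply/eqP; apply: contraT => yi.
  by have := term i yi; rewrite (psumr_eq0P _ sum0) // ltxx.
by move: x_neq0; rewrite xE y0 mul0mx eqxx.
Qed.

(** * Real matrices and their complex spectra *)

Definition bform {R : realType} {n} (M : 'M[R]_n) (u v : 'rV[R]_n) : R :=
  (u *m M *m v^T) ord0 ord0.

(** Transfers estimates from real to complex vectors without losing a constant:
    the cross terms between real and imaginary parts are purely imaginary. *)
Lemma Re_sesq_real {R : realType} {n} (M : 'M[R]_n) (x z : 'rV[R[i]%C]_n) :
  'Re (sesq (map_mx (real_complex R) M) x z) =
  (bform M (map_mx (@complex.Re R) x) (map_mx (@complex.Re R) z)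
   + bform M (map_mx (@complex.Im R) x) (map_mx (@complex.Im R) z))%:C%C.
Proof.
have bformE u v : bform M u v = \sum_i \sum_j u ord0 i * M i j * v ord0 j.
  rewrite /bform !mxE exchange_big; apply: eq_bigr => j _ /=.
  by rewrite !mxE mulr_suml; apply: eq_bigr => i _.
rewrite sesqE !bformE -big_split /= !raddf_sum /=; apply: eq_bigr => i _.
rewrite -big_split /= !raddf_sum /=; apply: eq_bigr => j _.
rewrite -complexRe !mxE; congr (_%:C%C).
case: (x ord0 i) (z ord0 j) => [a b] [e f] /=; ring.
Qed.

Lemma bform_ge0 {R : realType} {n} (A : 'M[R]_n) :
  (forall u, u != 0 -> 0 < bform A u u) -> forall u, 0 <= bform A u u.
Proof.
move=> Apos u; have [->|/Apos/ltW//] := eqVneq u 0.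
by rewrite /bform mul0mx mul0mx mxE.
Qed.

Lemma real_relative_perturbation {R : realType} {n} (A B : 'M[R]_n) (c : R) :
  0 <= c -> A^T = A ->
  (forall u, u != 0 -> 0 < bform A u u) ->
  (forall u v, bform (B - A) u v *+ 2 <= c ^+ 2 * bform A u u + bform A v v) ->
  forall l', spectrum B l' ->
  exists l, [/\ spectrum A l, 0 < l & `|l - l'| <= c%:C%C * l].
Proof.
move=> c_ge0 Asym Apos close l' Bl'.
have Re0 m (u : 'rV[R[i]%C]_m) : map_mx (@complex.Re R) u = 0 ->
    map_mx (@complex.Im R) u = 0 -> u = 0.
  move=> /rowP r0 /rowP i0; apply/rowP => i; move: (r0 i) (i0 i); rewrite !mxE.
  by case: (u ord0 i) => a b /= -> ->.
have A_ge0 := bform_ge0 A Apos.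
apply: (@relative_perturbation R[i]%C n (map_mx (real_complex R) A)
  (map_mx (real_complex R) B) c%:C%C _ _ _ _ l'); last exact: Bl'.
- by rewrite ler0c.
- apply: realsym_hermsym.
    apply/is_hermitianmxP; rewrite scale1r map_trmx; apply/matrixP => i j.
    by rewrite !mxE -[in LHS]Asym mxE.
  by apply/mxOverP => i j; rewrite mxE; apply/complex_realP; exists (A i j).
- move=> x x_neq0; rewrite Re_sesq_real ltcR.
  have [r0|/Apos r] := eqVneq (map_mx (@complex.Re R) x) 0; last by rewrite ltr_wpDr.
  have [i0|/Apos r] := eqVneq (map_mx (@complex.Im R) x) 0; last by rewrite ltr_wpDl.
  by rewrite (Re0 _ _ r0 i0) eqxx in x_neq0.
- move=> x z; rewrite -map_mxB !Re_sesq_real.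
  rewrite -rmorphXn -rmorphM -rmorphD -rmorphMn lecR.
  rewrite mulrnDl mulrDr [leRHS]addrACA; apply: lerD; exact: close.
Qed.


(** The perturbation bound for [B := A] and [c := 0] says that each eigenvalue of
    [A] is equal to a positive one. *)
Lemma eigenvalue_gt0 {R : realType} {n} (A : 'M[R]_n) :
  A^T = A -> (forall u, u != 0 -> 0 < bform A u u) ->
  forall l, spectrum A l -> 0 < l.
Proof.
move=> Asym Apos l Al.
have [u v|m [_ m_gt0]] :=
    real_relative_perturbation A A 0 (lexx 0) Asym Apos _ l Al.
  rewrite subrr /bform mulmx0 mul0mx mxE mul0rn expr0n mul0r add0r.
  exact: bform_ge0.
by rewrite mul0r normr_le0 subr_eq0 => /eqP <-.
Qed.

(** Needs an eigenvalue of [B], which exists over the complex numbers as soon as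
    [0 < n]: the supremum of the empty set is [-oo]. *)
Lemma relative_spectral_error_ge0 {R : realType} {n} (A B : 'M[R]_n) :
  (0 < n)%N -> (forall l, spectrum A l -> 0 < l) ->
  (0 <= relative_spectral_error A B)%E.
Proof.
move=> n_gt0 A_gt0.
have [l' Bl'] := eigenvalue_closed (map_mx (real_complex R) B) n_gt0.
apply: le_trans (ereal_sup_ubound _); last by exists l'; first exact: Bl'.
apply: le_ereal_inf_tmp => _ [l /A_gt0 l_gt0 <-].
have: 0 <= `|l - l'| / l by rewrite divr_ge0 // ltW.
by rewrite lecE lee_fin => /andP[].
Qed.

Lemma relative_spectral_error_le {R : realType} {n} (A B : 'M[R]_n) (c : R) :
  0 <= c -> A^T = A ->
  (forall u, u != 0 -> 0 < bform A u u) ->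
  (forall u v, bform (B - A) u v *+ 2 <= c ^+ 2 * bform A u u + bform A v v) ->
  (relative_spectral_error A B <= c%:E)%E.
Proof.
move=> c_ge0 Asym Apos close; apply: ge_ereal_sup => _ [l' Bl' <-].
have [l [Al l_gt0 ll']] :=
  real_relative_perturbation A B c c_ge0 Asym Apos close l' Bl'.
apply: le_trans (ereal_inf_lbound _) _; first by exists l; first exact: Al.
have: `|l - l'| / l <= c%:C%C by rewrite ler_pdivrMr.
by rewrite lecE lee_fin => /andP[].
Qed.

(** * Positivity of the Sobolev norm *)

Lemma L2norm_gt0 {R : realType} {d : nat} (O : set 'rV[R]_d) (u : 'rV[R]_d -> R) :
  L2 O u -> ~ eq_ae O u 0 -> 0 < L2norm O u.
Proof.
move=> Lu u_neq0; rewrite lt0r /L2norm fine_ge0 ?Lnorm_ge0 // andbT.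
apply: contra_notN u_neq0 => /eqP N0.
have /andP[mu /set_mem /= Nfin] := Lu.
have {}N0 : 'N[lebesgue_rV d]_2%:E[EFin \o (u \_ O)]%E = 0%E.
  by rewrite -[LHS]fineK ?N0 // ge0_fin_numE // Lnorm_ge0.
have : (EFin \o (u \_ O)) = \0%E %[ae lebesgue_rV d].
  apply: (Lnorm_eq0_eq0 _ _ N0) => //.
  by apply/measurable_EFinP; exact: set_mem mu.
by apply: filterS => x /= /(_ I) + Ox; rewrite patchE mem_set // => -[].
Qed.

(** The [L^2] part of the norm suffices, whatever representatives of the weak
    derivatives enter the definition. *)
Lemma H1norm_gt0 {R : realType} {d : nat} (O : set 'rV[R]_d) (u : 'rV[R]_d -> R) :
  L2 O u -> ~ eq_ae O u 0 -> 0 < H1norm O u.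
Proof.
move=> Lu u_neq0; rewrite sqrtr_gt0 ltr_wpDr ?exprn_gt0 ?L2norm_gt0 //.
by apply: sumr_ge0 => l _; exact: sqr_ge0.
Qed.

Lemma L2_linear {R : realType} {d : nat} (O : set 'rV[R]_d) :
  L2 O 0 /\ forall k u v, L2 O u -> L2 O v -> L2 O (k *: u + v).
Proof.
have two_ge1 : (1 <= 2%:E :> \bar R)%E by rewrite lee_fin ler1n.
have [L0 L1] := Lfun_submod_closed (lebesgue_rV d) two_ge1.
split=> [|k u v Lu Lv]; rewrite /L2.
  by rewrite (_ : _ \_ O = 0) //; apply/funext => x; rewrite patchE; case: ifP.
rewrite (_ : _ \_ O = k *: (u \_ O) + v \_ O); first exact: L1.
apply/funext => x; rewrite patchE [RHS]/GRing.add /= /GRing.scale /= !patchE.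
by case: ifP => // _; rewrite -[LHS](mulr0 k) -[LHS]addr0.
Qed.

(** * Matrices of bilinear forms *)

Section lincomb.
Context {R : realType} {E : lmodType R} (V : set E).
Hypotheses (V0 : V 0) (VD : forall k u v, V u -> V v -> V (k *: u + v)).

Lemma sub_sum {I : Type} (r : seq I) (Q : pred I) (c : I -> R) (f : I -> E) :
  (forall i, Q i -> V (f i)) -> V (\sum_(i <- r | Q i) c i *: f i).
Proof.
move=> Vf; elim: r => [|i r IHr]; first by rewrite big_nil.
by rewrite big_cons; case: ifP => // Qi; apply: VD => //; exact: Vf.
Qed.

Lemma lin_sum (g : E -> R) (I : Type) (r : seq I) (c : I -> R) (f : I -> E) :
  (forall k u v, V u -> V v -> g (k *: u + v) = k * g u + g v) ->
  (forall i, V (f i)) ->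
  g (\sum_(i <- r) c i *: f i) = \sum_(i <- r) c i * g (f i).
Proof.
move=> glin Vf; elim: r => [|i r IHr].
  rewrite !big_nil; have := glin 1 0 0 V0 V0.
  by rewrite scale1r addr0 mul1r => /esym/eqP; rewrite -subr_eq0 addrK => /eqP.
by rewrite !big_cons glin ?IHr //; exact: sub_sum.
Qed.

End lincomb.

(** The entry in position [(i, j)] is [b (phi j) (phi i)], hence the swap of [u]
    and [v]. *)
Lemma form_matrixE {R : realType} {d : nat} (V : set ('rV[R]_d -> R)) b n
    (phi : 'I_n -> 'rV[R]_d -> R) (u v : 'rV[R]_n) :
  V 0 -> (forall k f g, V f -> V g -> V (k *: f + g)) -> bilinear_on V b ->
  (forall k, V (phi k)) ->
  bform (form_matrix b phi) u v =
  b (\sum_k v ord0 k *: phi k) (\sum_k u ord0 k *: phi k).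
Proof.
move=> V0 VD [bl br] Vphi.
rewrite (lin_sum V V0 VD (b^~ (\sum_k u ord0 k *: phi k))) //; last first.
  by move=> k f g Vf Vg; apply: bl => //; exact: (sub_sum V V0 VD).
rewrite /bform mxE; apply: eq_bigr => j _.
rewrite !mxE mulrC; congr (_ * _).
rewrite (lin_sum V V0 VD (b (phi j))) //; last by move=> k f g Vf Vg; apply: br.
by apply: eq_bigr => i _; rewrite mxE.
Qed.

(** * The spline spaces *)

Lemma Vh_linear {R : realType} {d : nat} (P : spline_patch R d) :
  Vh P 0 /\ forall k u v, Vh P u -> Vh P v -> Vh P (k *: u + v).
Proof.
split=> [|k u v [cu ->] [cv ->]].
  by exists (fun=> 0); rewrite big1 // => i _; rewrite scale0r.
exists (fun i => k * cu i + cv i); rewrite scaler_sumr -big_split.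
by apply: eq_bigr => i _; rewrite scalerDl scalerA.
Qed.

Lemma Vh_L2 {R : realType} {d : nat} (P : spline_patch R d) :
  admissible_patch P -> Vh P `<=` L2 (patch_domain P)°.
Proof.
move=> [_ _ _ _ PH1] _ [c ->].
have [L0 LD] := @L2_linear R d (patch_domain P)°.
by apply: (sub_sum _ L0 LD) => i _; have [] := PH1 i.
Qed.

(** * Spectral error and form error *)

(** Completing the square gives the difference [al (k x - y)^2]. *)
Lemma weighted_AMGM {R : realType} (al k x y : R) : 0 <= al ->
  al * k * (y * x) *+ 2 <= k ^+ 2 * (al * x ^+ 2) + al * y ^+ 2.
Proof.
move=> al_ge0; rewrite -subr_ge0.
rewrite [leRHS](_ : _ = al * (k * x - y) ^+ 2); last by ring.
by rewrite mulr_ge0 // sqr_ge0.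
Qed.

(** The form error may be infinite, in which case the upper bound is trivial;
    otherwise coercivity converts it into the perturbation hypothesis of
    [relative_spectral_error_le] with [c = alpha^-1 * e]. *)
Lemma spectral_error_le_form_error {R : realType} {d : nat} (O : set 'rV[R]_d)
    (V : set ('rV[R]_d -> R)) (a ah : ('rV[R]_d -> R) -> ('rV[R]_d -> R) -> R)
    (alpha : R) n (phi : 'I_n -> 'rV[R]_d -> R) :
  (0 < n)%N -> V 0 -> (forall k f g, V f -> V g -> V (k *: f + g)) ->
  V `<=` L2 O -> bilinear_on V a -> bilinear_on V ah -> symmetric_on V a ->
  0 < alpha -> (forall v, V v -> alpha * H1norm O v ^+ 2 <= a v v) ->
  basis_on O V phi ->
  (0 <= relative_spectral_error (form_matrix a phi) (form_matrix ah phi)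
     <= alpha^-1%:E * form_error O V ah a)%E.
Proof.
move=> n_gt0 V0 VD VL2 abil ahbil asym alpha_gt0 acoer [Vphi _ phi_free].
set A := form_matrix a phi; set B := form_matrix ah phi.
pose w (u : 'rV[R]_n) := \sum_k u ord0 k *: phi k.
have Vw u : V (w u) by exact: (sub_sum V V0 VD).
have w_neq0 u : u != 0 -> ~ eq_ae O (w u) 0.
  by move=> u_neq0 /phi_free u0; case/eqP: u_neq0; apply/rowP => k; rewrite u0 mxE.
have w_gt0 u : u != 0 -> 0 < H1norm O (w u).
  by move=> /w_neq0; apply: H1norm_gt0; exact: VL2.
have AE u v : bform A u v = a (w v) (w u) by exact: (form_matrixE V).
have BE u v : bform B u v = ah (w v) (w u) by exact: (form_matrixE V).
have BAE u v : bform (B - A) u v = ah (w v) (w u) - a (w v) (w u).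
  by rewrite -AE -BE /bform mulmxBr mulmxBl !mxE.
have Asym : A^T = A by apply/matrixP => i j; rewrite !mxE asym.
have Apos u : u != 0 -> 0 < bform A u u.
  move=> u_neq0; rewrite AE; apply: lt_le_trans (acoer _ (Vw u)).
  by rewrite mulr_gt0 // exprn_gt0 // w_gt0.
have A_ge0 := bform_ge0 A Apos.
have err u v : u != 0 -> v != 0 ->
    ((`|bform (B - A) u v| / (H1norm O (w v) * H1norm O (w u)))%:E
     <= form_error O V ah a)%E.
  move=> u_neq0 v_neq0; rewrite BAE; apply: ereal_sup_ubound.
  exists (w v), (w u); split=> //; exact: w_neq0.
have : (0 <= form_error O V ah a)%E.
  have one_neq0 : const_mx 1 != 0 :> 'rV[R]_n.
    apply/eqP => /rowP/(_ (Ordinal n_gt0)); rewrite !mxE; exact/eqP/oner_neq0.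
  apply: le_trans (err _ _ one_neq0 one_neq0).
  by rewrite lee_fin divr_ge0 // ltW // mulr_gt0 ?w_gt0.
move=> err_ge0; rewrite relative_spectral_error_ge0 //=; last exact: eigenvalue_gt0.
case: (form_error O V ah a) err err_ge0 => [e| |] //= err e_ge0; last first.
  by rewrite gt0_muley ?leey // lte_fin invr_gt0.
rewrite -EFinM; apply: relative_spectral_error_le => //.
  by rewrite mulr_ge0 ?invr_ge0 // ltW.
move=> u v.
have [->|u_neq0] := eqVneq u 0.
  by rewrite {1 2}/bform !mul0mx mxE mul0rn mulr0 add0r.
have [->|v_neq0] := eqVneq v 0.
  rewrite {1 3}/bform trmx0 !mulmx0 mxE mul0rn addr0.
  by rewrite mulr_ge0 ?exprn_even_ge0 //.
have := err _ _ u_neq0 v_neq0.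
rewrite lee_fin ler_pdivrMr ?mulr_gt0 ?w_gt0 // => uv.
have := acoer _ (Vw u); have := acoer _ (Vw v); rewrite -!AE.
set x := H1norm O (w u) in uv *; set y := H1norm O (w v) in uv * => vA uA.
apply: (@le_trans _ _ (e * (y * x) *+ 2)).
  by rewrite lerMn2r; apply: le_trans uv; exact: ler_norm.
have {1}-> : e = alpha * (alpha^-1 * e) by rewrite mulVKf ?gt_eqF.
apply: le_trans (weighted_AMGM alpha _ _ _ (ltW alpha_gt0)) _.
by rewrite lerD // ler_wpM2l // sqr_ge0.
Qed.

Local Close Scope sesquilinear_scope.

Theorem proposition1 (R : realType) (d : nat) (d23 : d = 2%N \/ d = 3%N)
  (Omega : set 'rV[R]_d)
  (* the mesh sizes of the family *)
  (H : set R) (H_gt0 : forall h, H h -> 0 < h)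
  (H_acc : forall e : R, 0 < e -> exists2 h, H h & h < e)
  (P : R -> spline_patch R d)
  (P_adm : forall h, H h -> admissible_patch (P h))
  (P_mesh : forall h, H h -> mesh_size (P h) = h)
  (P_dom : forall h, H h -> patch_domain (P h) = Omega)
  (a ah : R -> ('rV[R]_d -> R) -> ('rV[R]_d -> R) -> R)
  (a_bil : forall h, H h -> bilinear_on (Vh (P h)) (a h))
  (a_sym : forall h, H h -> symmetric_on (Vh (P h)) (a h))
  (a_coercive : exists2 alpha : R, 0 < alpha &
     forall h, H h -> forall v, Vh (P h) v ->
       alpha * H1norm Omega° v ^+ 2 <= a h v v)
  (ah_bil : forall h, H h -> bilinear_on (Vh (P h)) (ah h))
  (ah_close : form_error Omega° (Vh (P h)) (ah h) (a h)
     @[h --> within H 0^'+] --> 0%E)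
  (phi : forall h, 'I_(dim_Vh (P h)) -> 'rV[R]_d -> R)
  (phi_basis : forall h, H h -> basis_on Omega° (Vh (P h)) (phi h)) :
  relative_spectral_error (form_matrix (a h) (phi h))
      (form_matrix (ah h) (phi h))
    @[h --> within H 0^'+] --> 0%E.
Proof.
have [alpha alpha_gt0 acoer] := a_coercive.
pose bound h := (alpha^-1%:E * form_error Omega° (Vh (P h)) (ah h) (a h))%E.
apply: (@squeeze_cvge _ _ _ _ (cst 0%E) _ bound); first last.
- by rewrite -(mule0 alpha^-1%:E); exact: cvgeZl.
- exact: cvg_cst.
apply: filterS (withinT _ _) => h Hh.
have [_ dim_gt0 _ _ _] := P_adm h Hh.
have [V0 VD] := Vh_linear (P h).
have VL2 : Vh (P h) `<=` L2 Omega°.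
  by rewrite -(P_dom h Hh); apply: Vh_L2; exact: P_adm.
apply: (spectral_error_le_form_error _ _ _ _ _ _ _ dim_gt0 V0 VD VL2
  (a_bil h Hh) (ah_bil h Hh) (a_sym h Hh) alpha_gt0 (acoer h Hh)
  (phi_basis h Hh)).
Qed.
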